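(* Let $n,m\in\mathbb{N}$ be positive, let $c,c^1,\dots,c^m\in\mathbb{R}^n$ and let $R,r>0$. Let $\mathcal{C}_1=\bigcap_{k=1}^m\{x\in\mathbb{R}^n:\|x-c^k\|\le R\}$ and $\mathcal{C}_0=\{x\in\mathbb{R}^n:\|x-c\|\le r\}$. Let $G:\mathbb{R}^n\to\mathbb{R}$ be the function defined in the context from these data, and let $x^\star\in\mathbb{R}^n$ be a global minimizer of $G$ over $\mathbb{R}^n$, i.e. $x^\star=\mathrm{argmin}_{x\in\mathbb{R}^n}G(x)$. If $d(c,\mathcal{C}_1)>R$, then $$\mathcal{C}_1\setminus\mathrm{int}(\mathcal{C}_0)\neq\emptyset\iff x^\star\in\mathcal{C}_1\setminus\mathrm{int}(\mathcal{C}_0).$$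
   Context: $\|\cdot\|$ is the Euclidean norm on $\mathbb{R}^n$, $d(c,\mathcal{C}_1)=\inf_{x\in\mathcal{C}_1}\|c-x\|$ is the Euclidean distance from the point $c$ to the set $\mathcal{C}_1$, and $\mathrm{int}$ denotes topological interior in $\mathbb{R}^n$. Define, for $x\in\mathbb{R}^n$ and $k\in\{1,\dots,m\}$, $$f_k(x)=\|x-c^k\|^2-R^2,\qquad f(x)=\|x-c\|^2-r^2,$$ $$f_k^+(x)=\max\{f_k(x),0\},\qquad f^-(x)=\min\{f(x),0\}$$ (so $f^-(x)\le 0$; this is not the usual negative part). Define $$G_k(x)=f_k(x)-f^-(x)+\sum_{i=1,\,i\ne k}^m f_i^+(x),\qquad G(x)=\max_{k\in\{1,\dots,m\}}G_k(x).$$ *)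

(* Defs.v *)
From mathcomp Require Import all_boot all_order all_algebra.
From mathcomp Require Import all_classical all_reals all_analysis.
Import Order.TTheory GRing.Theory Num.Theory.
Import numFieldNormedType.Exports.

Set Implicit Arguments.
Unset Strict Implicit.
Unset Printing Implicit Defensive.

Local Open Scope classical_set_scope.
Local Open Scope ring_scope.

(* The library norm `|x| on row vectors is the sup norm, so the Euclidean one
   is defined here.  Both induce the canonical topology of 'rV[R]_n, hence the
   library's interior is the Euclidean interior. *)
Definition enorm (R : realType) (n : nat) (x : 'rV[R]_n) : R :=
  Num.sqrt (\sum_(i < n) x ord0 i ^+ 2).

(* Extended-real valued, so that the distance to the empty set is +oo. *)
Definition edistance (R : realType) (n : nat) (a : 'rV[R]_n)
    (A : set 'rV[R]_n) : \bar R :=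
  ereal_inf [set (enorm (a - x))%:E | x in A].

Definition eball (R : realType) (n : nat) (a : 'rV[R]_n) (rho : R)
    : set 'rV[R]_n :=
  [set x | enorm (x - a) <= rho].

Definition C1 (R : realType) (n m : nat) (cs : 'I_m -> 'rV[R]_n) (rho : R)
    : set 'rV[R]_n :=
  \bigcap_(k : 'I_m) eball (cs k) rho.

Definition C0 (R : realType) (n : nat) (c : 'rV[R]_n) (r : R)
    : set 'rV[R]_n :=
  eball c r.

(* fquad (cs k) rho is f_k, and fquad c r is f. *)
Definition fquad (R : realType) (n : nat) (a : 'rV[R]_n) (rho : R)
    (x : 'rV[R]_n) : R :=
  enorm (x - a) ^+ 2 - rho ^+ 2.

Definition Gk (R : realType) (n m : nat) (c : 'rV[R]_n)
    (cs : 'I_m -> 'rV[R]_n) (rho r : R) (k : 'I_m) (x : 'rV[R]_n) : R :=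
  fquad (cs k) rho x - Num.min (fquad c r x) 0
  + \sum_(i < m | i != k) Num.max (fquad (cs i) rho x) 0.

(* The seed of the iterated maximum is one of its terms, hence harmless. *)
Definition G (R : realType) (n m : nat) (c : 'rV[R]_n)
    (cs : 'I_m.+1 -> 'rV[R]_n) (rho r : R) (x : 'rV[R]_n) : R :=
  \big[Num.max/Gk c cs rho r ord0 x]_(k < m.+1) Gk c cs rho r k x.

(* Main.v *)
Require Import Defs.
From mathcomp Require Import all_boot all_order all_algebra.
From mathcomp Require Import all_classical all_reals all_analysis.
From mathcomp Require Import ring lra.
Import Order.TTheory GRing.Theory Num.Theory.
Import numFieldNormedType.Exports.

Local Open Scope classical_set_scope.
Local Open Scope ring_scope.

(** Suppose some point of C1 lies outside the interior of C0.  At that point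
    every f_k is nonpositive and f^- vanishes, so the minimum of G is at most 0.
    If f_k were positive at a minimizer p, then so would be G_k, all the
    other terms of G_k being nonnegative; hence p lies in C1.

    It remains to exclude f(p) < 0.  In that case G_k(p) = f_k(p) - f(p),
    and G(p) <= 0 forces f_k(p) <= f(p) < 0 for every k: all the
    constraints hold strictly, and near p the function G is the maximum of the
    functions f_k - f, which are affine because the quadratic parts cancel.
    Now push p a little away from c.  Since the distance from c to C1 exceeds
    rho, p is within rho of every center c^k but farther than rho from c, so
    each f_k - f is smaller at p than at c; being affine, it
    keeps decreasing beyond p along the ray from c.  So G takes a smaller
    value there, which is absurd.  The affine step is [fquadB_ray], the
    comparison with c is [fquadB_lt_center], and the descent is
    [G_decreases_away_from_center]. *)

Lemma enorm_ge0 (R : realType) (n : nat) (x : 'rV[R]_n) : 0 <= enorm x.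
Proof. exact: sqrtr_ge0. Qed.

Lemma sqr_enorm (R : realType) (n : nat) (x : 'rV[R]_n) :
  enorm x ^+ 2 = \sum_(i < n) x ord0 i ^+ 2.
Proof. by rewrite sqr_sqrtr // sumr_ge0 // => i _; rewrite sqr_ge0. Qed.

Lemma enormZ (R : realType) (n : nat) (t : R) (x : 'rV[R]_n) :
  enorm (t *: x) = `|t| * enorm x.
Proof.
rewrite -sqrtr_sqr -sqrtrM ?sqr_ge0 //; congr Num.sqrt.
by rewrite mulr_sumr; apply: eq_bigr => i _; rewrite mxE exprMn.
Qed.

Lemma enormN (R : realType) (n : nat) (x : 'rV[R]_n) : enorm (- x) = enorm x.
Proof. by rewrite -scaleN1r enormZ normrN1 mul1r. Qed.

Lemma fquad_lt0 (R : realType) (n : nat) (a : 'rV[R]_n) (rho : R)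
    (x : 'rV[R]_n) : 0 <= rho -> (fquad a rho x < 0) = (enorm (x - a) < rho).
Proof. by move=> rho0; rewrite subr_lt0 ltr_pXn2r // nnegrE ?enorm_ge0. Qed.

Lemma fquad_le0 (R : realType) (n : nat) (a : 'rV[R]_n) (rho : R)
    (x : 'rV[R]_n) : 0 <= rho -> (fquad a rho x <= 0) = (enorm (x - a) <= rho).
Proof. by move=> rho0; rewrite subr_le0 ler_pXn2r // nnegrE ?enorm_ge0. Qed.

Lemma C1P (R : realType) (n m : nat) (cs : 'I_m -> 'rV[R]_n) (rho : R)
    (x : 'rV[R]_n) :
  0 <= rho -> C1 cs rho x <-> forall k, fquad (cs k) rho x <= 0.
Proof.
move=> rho0; split=> [Cx k|fx k _]; first by rewrite fquad_le0 //; exact: Cx.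
by rewrite /eball /= -fquad_le0.
Qed.

Lemma fquad_continuous (R : realType) (n : nat) (a : 'rV[R]_n.+1) (rho : R) :
  continuous (fquad a rho).
Proof.
have -> : fquad a rho =
    (fun x => \sum_(i < n.+1) (x ord0 i - a ord0 i) ^+ 2 - rho ^+ 2).
  apply/funext => x; rewrite /fquad sqr_enorm; congr (_ - _).
  by apply: eq_bigr => i _; rewrite !mxE.
move=> x; apply: (@cvgB _ _ _ (nbhs x)); last exact: cvg_cst.
apply: cvg_big => [|i _]; first exact: add_continuous.
have cvgi : (fun y : 'rV[R]_n.+1 => y ord0 i - a ord0 i) y @[y --> x] -->
    x ord0 i - a ord0 i.
  by apply: (@cvgB _ _ _ (nbhs x)); [exact: coord_continuous | exact: cvg_cst].
exact: cvgM.
Qed.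

(** The quadratic parts cancel in the difference, which is therefore affine;
    the identity is affinity along the line through [c] and [x]. *)
Lemma fquadB_ray (R : realType) (n : nat) (a c x : 'rV[R]_n) (rho r t : R) :
  let h y := fquad a rho y - fquad c r y in
  h (x + t *: (x - c)) = h x + t * (h x - h c).
Proof.
rewrite /fquad !sqr_enorm /=.
have step (A A' A'' B B' B'' : R) :
    A - B = A' - B' + t * ((A' - B') - (A'' - B'')) ->
    A - rho ^+ 2 - (B - r ^+ 2) = A' - rho ^+ 2 - (B' - r ^+ 2) +
      t * (A' - rho ^+ 2 - (B' - r ^+ 2) - (A'' - rho ^+ 2 - (B'' - r ^+ 2))).
  by lra.
apply: step; rewrite -!sumrB mulr_sumr -big_split /=.
by apply: eq_bigr => i _; rewrite !mxE; ring.
Qed.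

Lemma C1_enorm_gt (R : realType) (n m : nat) (c : 'rV[R]_n)
    (cs : 'I_m -> 'rV[R]_n) (rho : R) (x : 'rV[R]_n) :
  (rho%:E < edistance c (C1 cs rho))%E -> C1 cs rho x -> rho < enorm (x - c).
Proof.
move=> hdist Cx; rewrite -enormN opprB -lte_fin.
by apply: lt_le_trans hdist _; apply: ereal_inf_lbound; exists x.
Qed.

(** Up to the constant [r ^+ 2 - rho ^+ 2], the difference is negative at [x],
    which is closer to [a] than to [c], and is a squared norm at [c]. *)
Lemma fquadB_lt_center (R : realType) (n : nat) (a c x : 'rV[R]_n)
    (rho r : R) :
  0 <= rho -> fquad a rho x <= 0 -> rho < enorm (x - c) ->
  fquad a rho x - fquad c r x < fquad a rho c - fquad c r c.
Proof.
move=> rho0; rewrite /fquad => fx.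
rewrite -(ltr_pXn2r (isT : (0 < 2)%N)) ?nnegrE ?enorm_ge0 // => xc.
have -> : enorm (c - c) ^+ 2 = 0.
  by rewrite subrr sqr_enorm big1 // => i _; rewrite mxE expr0n.
have := sqr_ge0 (enorm (c - a)); lra.
Qed.

Lemma ray_cvg (R : realType) (n : nat) (c x : 'rV[R]_n.+1) :
  x + t *: (x - c) @[t --> (0 : R)^'+] --> x.
Proof.
apply: cvg_at_right_filter; rewrite -[Y in _ --> Y]addr0 -(scale0r (x - c)).
by apply: cvgD; [exact: cvg_cst | apply: cvgZr_tmp; exact: cvg_id].
Qed.

(** A boundary point of the ball is left by moving away from the center, so it
    is not interior; conversely the open ball is open by continuity. *)
Lemma interior_C0P (R : realType) (n : nat) (c x : 'rV[R]_n.+1) (r : R) :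
  0 < r -> interior (C0 c r) x <-> fquad c r x < 0.
Proof.
move=> r0; split=> [|fx].
  move=> /(ray_cvg _ _ c x) intx; rewrite fquad_lt0 ?ltW //.
  have [t [t0]] : exists t : R, 0 < t /\ C0 c r (x + t *: (x - c)).
    near (0 : R)^'+ => t; exists t; split; near: t => //.
    exact: nbhs_right_gt.
  rewrite /C0 /eball /=.
  have -> : x + t *: (x - c) - c = (1 + t) *: (x - c).
    by rewrite scalerDl scale1r addrAC.
  rewrite enormZ ger0_norm; last lra.
  have := enorm_ge0 _ _ (x - c); nra.
have : \forall y \near x, fquad c r y < 0.
  exact: (cvgr_lt _ (fquad_continuous _ _ c r x)).
by apply: filterS => y; rewrite fquad_lt0 ?ltW // => /ltW.
Unshelve. all: by end_near. Qed.

Lemma Gk_le_G (R : realType) (n m : nat) (c : 'rV[R]_n)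
    (cs : 'I_m.+1 -> 'rV[R]_n) (rho r : R) (k : 'I_m.+1) (x : 'rV[R]_n) :
  Gk c cs rho r k x <= G c cs rho r x.
Proof. exact: (le_bigmax _ (fun k => Gk c cs rho r k x)). Qed.

Lemma Gk_ge_fquad (R : realType) (n m : nat) (c : 'rV[R]_n)
    (cs : 'I_m -> 'rV[R]_n) (rho r : R) (k : 'I_m) (x : 'rV[R]_n) :
  fquad (cs k) rho x - Num.min (fquad c r x) 0 <= Gk c cs rho r k x.
Proof. by rewrite lerDl sumr_ge0 // => i _; rewrite le_max lexx orbT. Qed.

Lemma Gk_feasible (R : realType) (n m : nat) (c : 'rV[R]_n)
    (cs : 'I_m -> 'rV[R]_n) (rho r : R) (k : 'I_m) (x : 'rV[R]_n) :
  (forall i, fquad (cs i) rho x <= 0) ->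
  Gk c cs rho r k x = fquad (cs k) rho x - Num.min (fquad c r x) 0.
Proof. by move=> fx; rewrite /Gk big1 ?addr0 // => i _; exact/max_idPr. Qed.

(** Strictness of the inequalities at [x] keeps G equal to the maximum of the
    affine functions f_k - f along a short piece of the ray. *)
Lemma G_decreases_away_from_center (R : realType) (n m : nat)
    (c : 'rV[R]_n.+1) (cs : 'I_m.+1 -> 'rV[R]_n.+1) (rho r : R)
    (x : 'rV[R]_n.+1) :
  0 <= rho -> (forall k, fquad (cs k) rho x < 0) -> fquad c r x < 0 ->
  rho < enorm (x - c) ->
  exists y, G c cs rho r y < G c cs rho r x.
Proof.
move=> rho0 fkx fx xc.
have ray_lt0 a s : fquad a s x < 0 ->
    \forall t \near (0 : R)^'+, fquad a s (x + t *: (x - c)) < 0.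
  move=> asx; have nx : \forall y \near x, fquad a s y < 0.
    exact: (cvgr_lt _ (fquad_continuous _ _ a s x)).
  exact: (ray_cvg _ _ c x _ nx).
have [t [t0 ft fkt]] : exists t : R, [/\ 0 < t,
    fquad c r (x + t *: (x - c)) < 0 &
    forall k, fquad (cs k) rho (x + t *: (x - c)) < 0].
  near (0 : R)^'+ => t; exists t; split.
  - by near: t; exact: nbhs_right_gt.
  - by near: t; exact: ray_lt0.
  - by near: t; apply: filter_forall => k; exact: ray_lt0.
exists (x + t *: (x - c)).
have Gk_lt k : Gk c cs rho r k (x + t *: (x - c)) < G c cs rho r x.
  apply: lt_le_trans (Gk_le_G _ _ _ c cs rho r k x).
  rewrite !Gk_feasible; do ?by move=> i; apply: ltW.
  rewrite !(min_idPl _) ?ltW // fquadB_ray.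
  have := fquadB_lt_center _ _ _ _ _ _ r rho0 (ltW (fkx k)) xc; nra.
by apply/bigmax_ltP; split.
Unshelve. all: by end_near. Qed.

Theorem theorem2p9 (R : realType) (n m : nat) (c : 'rV[R]_n.+1)
    (cs : 'I_m.+1 -> 'rV[R]_n.+1) (rho r : R) (hrho : 0 < rho) (hr : 0 < r)
    (xstar : 'rV[R]_n.+1)
    (hmin : forall x : 'rV[R]_n.+1, G c cs rho r xstar <= G c cs rho r x)
    (hdist : (rho%:E < edistance c (C1 cs rho))%E) :
  C1 cs rho `\` interior (C0 c r) !=set0 <->
  (C1 cs rho `\` interior (C0 c r)) xstar.
Proof.
split=> [[y [Cy Iy]]|Cx]; last by exists xstar.
have rho0 := ltW hrho.
have Gx0 : G c cs rho r xstar <= 0.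
  apply: le_trans (hmin y) _.
  have fy : forall k, fquad (cs k) rho y <= 0 by apply/C1P.
  have fy0 : 0 <= fquad c r y.
    by rewrite leNgt; apply/negP => fy0; apply: Iy; exact/interior_C0P.
  have Gky k : Gk c cs rho r k y <= 0.
    by rewrite Gk_feasible // (min_idPr fy0) subr0.
  by apply/bigmax_leP; split.
have fkx k : fquad (cs k) rho xstar - Num.min (fquad c r xstar) 0 <= 0.
  by apply: le_trans Gx0; apply: le_trans (Gk_le_G _ _ _ _ _ _ _ k _);
     exact: Gk_ge_fquad.
have Cx : C1 cs rho xstar.
  apply/C1P => // k; have := fkx k.
  have : Num.min (fquad c r xstar) 0 <= 0 by rewrite ge_min lexx orbT.
  lra.
split=> // /(interior_C0P _ _ _ _ _ hr) fx.
have fkx0 k : fquad (cs k) rho xstar < 0.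
  by have := fkx k; rewrite (min_idPl (ltW fx)); lra.
have [z] := G_decreases_away_from_center _ _ _ _ _ _ _ _ rho0 fkx0 fx
  (C1_enorm_gt _ _ _ _ _ _ _ hdist Cx).
by rewrite ltNge hmin.
Qed.
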